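(* Let $\Gamma$ be a group with property $\mathcal{DP}$, witnessed by a sequence of groups $(\Gamma_i)_{i\in\mathbb N}$ with property $\mathcal{DP}$ such that $\Gamma\simeq\Gamma_0$, with associated subgroups $A_i,H_i\le \Gamma_i$ and valency sequence $(d_i)_{i\in\mathbb N}$. Assume that the group $H=H_0$ is amenable and that $\frac{d_k}{\log k}\to 0$ as $k\to\infty$. Then the group $\Gamma$ is amenable.
   Context: Permutational wreath product: if a group $A$ acts on $\{1,\dots,d\}$, then $G\wr A=(G\times\dots\times G)\rtimes A$ ($d$ factors), where $A$ permutes the factors. Elements are written $(g_1,\dots,g_d)\sigma$ with $\sigma \in A$, and the product is $(g_1,\dots,g_d)\sigma\cdot(g'_1,\dots,g'_d)\sigma'=(g_1g'_{\sigma(1)},\dots,g_dg'_{\sigma(d)})\sigma\sigma'$, where permutations are composed from left to right, i.e. $(\sigma\sigma')(t)=\sigma'(\sigma(t))$. The action of $A$ need not be faithful. Property $\mathcal{DP}$: a sequence of groups $(\Gamma_i)_{i\in\mathbb N}$ has property $\mathcal{DP}$ if for all $i\in\mathbb N$: (1) $\Gamma_i$ contains two subgroups $A_i$ and $H_i$ such that (a) $A_i\cup H_i$ generates $\Gamma_i$; (b) $A_i$ is finite and acts transitively on a finite set $\{1,\dots,d_i\}$ of size $d_i\ge 2$; (c) $H_i$ is finitely generated; (2) there is an isomorphism $\varphi_i:\Gamma_i\to\Gamma_{i+1}\wr A_i=(\Gamma_{i+1}\times\dots\times\Gamma_{i+1})\rtimes A_i$, with $d_i$ factors permuted by $A_i$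 according to its action on $\{1,\dots,d_i\}$, such that (a) for every $s\in A_i$, $\varphi_i(s)=(e,\dots,e)s$; (b) for every $h_i\in H_i$ there exist $h_{i+1}\in H_{i+1}$, $a_2,\dots,a_{d_i}\in A_{i+1}$ and $\rho\in A_i$ with $\rho(1)=1$ such that $\varphi_i(h_i)=(h_{i+1},a_2,\dots,a_{d_i})\rho$. Here $A_{i+1},H_{i+1}$ are the subgroups of $\Gamma_{i+1}$ from condition (1). A group $\Gamma$ has property $\mathcal{DP}$ if there is a sequence $(\Gamma_i)_{i\in\mathbb N}$ with property $\mathcal{DP}$ such that $\Gamma\simeq\Gamma_0$. *)

(* Defs.v *)
From HB Require Import structures.
From mathcomp Require Import all_boot all_order all_algebra.
From mathcomp Require Import all_classical all_reals all_analysis.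

Set Implicit Arguments.
Unset Strict Implicit.
Unset Printing Implicit Defensive.

Import Order.TTheory GRing.Theory Num.Theory.
Import numFieldNormedType.Exports.

Local Open Scope classical_set_scope.
Local Open Scope group_scope.

Section Subgroups.
Variable G : groupType.

Record subgroup_of (S : groupClosed G) :=
  SubgroupOf { sgval : G; sgvalP : sgval \in S }.

HB.instance Definition _ (S : groupClosed G) := [isSub of subgroup_of S for @sgval S].
HB.instance Definition _ (S : groupClosed G) := [Choice of subgroup_of S by <:].

Lemma group_closed_subgroup (S : groupClosed G) : group_closed S.
Proof. by split; [exact: gpred1 | exact: gpredF]. Qed.

HB.instance Definition _ (S : groupClosed G) :=
  SubChoice_isSubGroup.Build G (mem S) (subgroup_of S) (group_closed_subgroup S).

(* the subgroup generated by X contains Y *)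
Definition generates (X Y : {pred G}) :=
  forall K : groupClosed G, {subset X <= K} -> {subset Y <= K}.

Definition finitely_generated (S : groupClosed G) :=
  exists2 F : seq G, {subset F <= S} & generates [in F] S.

End Subgroups.

Definition isomorphic (G H : groupType) :=
  exists f : {multiplicative G -> H}, bijective f.

Definition amenable (R : realType) (G : groupType) :=
  exists m : set G -> R,
    [/\ forall A, (0 <= m A)%R,
        m [set: G] = 1%R,
        forall A B, A `&` B = set0 -> m (A `|` B) = (m A + m B)%R
      & forall (g : G) A, m [set g * x | x in A] = m A].

(* A group acting on the right, as permutations are composed from left to      *)
(* right: the image of t under s is act t s, written s(t) in the mathematics.  *)
Record right_action (A : groupType) (T : Type) := RightAction {
  act :> T -> A -> T;
  act1 : forall t, act t 1 = t;
  actM : forall t s s', act t (s * s') = act (act t s) s'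
}.

Definition transitive_action (A : groupType) T (to : right_action A T) :=
  forall t t' : T, exists s, to t s = t'.

Definition wreath (G A : groupType) (d : nat) (to : right_action A 'I_d) :=
  ({ffun 'I_d -> G} * A)%type.

Section Wreath.
Variables (G A : groupType) (d : nat) (to : right_action A 'I_d).
Local Notation W := (wreath G to).
Implicit Types u v : W.

Definition wr (g : {ffun 'I_d -> G}) (s : A) : W := (g, s).

Definition wreath_one : W := wr 1 1.
Definition wreath_mul u v : W :=
  wr [ffun t => u.1 t * v.1 (to t u.2)] (u.2 * v.2).
Definition wreath_inv u : W :=
  wr [ffun t => (u.1 (to t u.2^-1))^-1] u.2^-1.

Lemma wreath_mulA : associative wreath_mul.
Proof.
move=> u v w; congr pair; last exact: mulgA.
by apply/ffunP => t; rewrite /= !ffunE /= actM mulgA.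
Qed.

Lemma wreath_mul1 : left_id wreath_one wreath_mul.
Proof.
case=> g s; congr pair; last exact: mul1g.
by apply/ffunP => t; rewrite !ffunE /= act1 mul1g.
Qed.

Lemma wreath_mulr1 : right_id wreath_one wreath_mul.
Proof.
case=> g s; congr pair; last exact: mulg1.
by apply/ffunP => t; rewrite !ffunE /= mulg1.
Qed.

Lemma wreath_mulV : left_inverse wreath_one wreath_inv wreath_mul.
Proof.
case=> g s; congr pair; last exact: mulVg.
by apply/ffunP => t; rewrite !ffunE /= mulVg.
Qed.

Lemma wreath_mulrV : right_inverse wreath_one wreath_inv wreath_mul.
Proof.
case=> g s; congr pair; last exact: mulgV.
by apply/ffunP => t; rewrite !ffunE /= -actM mulgV act1 mulgV.
Qed.

HB.instance Definition _ := Choice.copy W ({ffun 'I_d -> G} * A)%type.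
HB.instance Definition _ := isGroup.Build W
  wreath_mulA wreath_mul1 wreath_mulr1 wreath_mulV wreath_mulrV.

End Wreath.

Arguments wr {G A d to} g s.

(* The set {1, ..., d} is represented by 'I_d, so its element 1 is the ordinal *)
(* of value 0.                                                                 *)
Definition first d (d_gt1 : (1 < d)%N) : 'I_d := Ordinal (ltnW d_gt1).

Record DP (Gam : nat -> groupType) := {
  dpA : forall i, groupClosed (Gam i);
  dpH : forall i, groupClosed (Gam i);
  dpd : nat -> nat;
  dpact : forall i, right_action (subgroup_of (dpA i)) 'I_(dpd i);
  dpphi : forall i, {multiplicative Gam i -> wreath (Gam i.+1) (dpact i)};
  dp_gen : forall i, generates [predU dpA i & dpH i] predT;
  dpA_finite : forall i, finite_set [set` dpA i];
  dpd_gt1 : forall i, (1 < dpd i)%N;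
  dpact_trans : forall i, transitive_action (dpact i);
  dpH_fg : forall i, finitely_generated (dpH i);
  dpphi_bij : forall i, bijective (dpphi i);
  dpphiA : forall i (s : subgroup_of (dpA i)), dpphi i (val s) = wr 1 s;
  dpphiH : forall i (h : subgroup_of (dpH i)),
    exists (h' : subgroup_of (dpH i.+1))
           (a : 'I_(dpd i) -> subgroup_of (dpA i.+1))
           (rho : subgroup_of (dpA i)),
      dpact i (first (dpd_gt1 i)) rho = first (dpd_gt1 i) /\
      dpphi i (val h) =
        wr [ffun t => if t == first (dpd_gt1 i) then val h' else val (a t)] rho
}.

(* Main.v *)
From HB Require Import structures.
Require Import Defs.
From mathcomp Require Import all_boot all_order all_algebra.
From mathcomp Require Import finmap.
From mathcomp Require Import all_classical all_reals all_analysis.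
From mathcomp Require Import ring lra zify.

Set Implicit Arguments.
Unset Strict Implicit.
Unset Printing Implicit Defensive.

Import Order.TTheory GRing.Theory Num.Theory.
Import numFieldNormedType.Exports.
Local Open Scope classical_set_scope.
Local Open Scope ring_scope.

(* Let f be a unit vector of l2(Gam_(i+1)) fixed by A_(i+1), g a unit vector    *)
(* almost fixed by the image of H_0 in H_(i+1), and c = <f, g>^2. In            *)
(* l2(Gam_i), identified by phi_i with l2(Gam_(i+1))^(x d) (x) l2(A_i), let     *)
(* eta_t be the product of g at site t, f at the other sites, and the uniform   *)
(* unit vector of l2(A_i). As the coordinates other than the first of an        *)
(* element of H_i lie in A_(i+1) and fix f, the vector eta_1 is as invariant    *)
(* under H_0 as g is; the normalized sum of all the eta_t is fixed by A_i; and  *)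
(* the squared cosine of their angle is 1/d + (1 - 1/d) c. So each level        *)
(* multiplies 1 - c by 1 - 1/d_i, and when d_k <= k eventually the product of   *)
(* these factors vanishes: H_0 being amenable, one may start at level k from a  *)
(* Foelner set of its image in Gam_k and the indicator of A_k, and reach vectors*)
(* of l2(Gam_0) almost fixed by A_0 and by generators of H_0.                   *)

(** Amenability passes through almost invariant vectors. The mean on H_0 pushes forward to each
    Gam_i along [spine], so the image of H_0 has Foelner sets there ([mean_folner], by Hall's
    theorem) and hence almost fixed unit vectors ([aligned_start]). Each descent by one level
    multiplies the defect 1 - c by 1 - 1/d_i and costs nothing in the invariance under H_0
    ([aligned_step]). Over many levels the product of these factors becomes arbitrarily small, since
    d_k <= k eventually ([prod_telescope]). At level 0 this leaves one vector almost fixed both by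
    A_0 and by generators of H_0 ([almost_invariant_vector]). Its squared coordinates form an almost
    invariant mean on Gam_0 ([vector_mean_almost_invariant]). An ultralimit of such means
    ([limit_mean]) is invariant under a generating set, hence under Gam_0. *)

Section Hall.
Variables I X : choiceType.
Implicit Types (M N : I -> {fset X}) (J : {fset I}).
Local Open Scope fset_scope.
Local Open Scope nat_scope.

Definition hall N := forall J, #|` J| <= #|` \bigcup_(j <- J) N j|.

(** Zorn's lemma for reverse inclusion: a chain is bounded by its pointwise intersection. That
    intersection satisfies Hall's condition because, the sets being finite, on each finite [J] it
    coincides with a single member of the chain. *)
Lemma hall_minimal N : hall N ->
  exists M, [/\ forall i, M i `<=` N i, hall M
    & forall M', (forall i, M' i `<=` M i) -> hall M' -> M' = M].
Proof.
move=> hallN.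
pose T := {M | (forall i, M i `<=` N i) /\ hall M}.
pose R (s t : T) := `[< forall i, sval t i `<=` sval s i >].
have [t|r s t /asboolP rs /asboolP st|s t /asboolP st /asboolP ts|A Atot|
    [M [MN hallM]] Mmin] := @Zorn T R.
- by apply/asboolP.
- by apply/asboolP => i; apply: fsubset_trans (st i) (rs i).
- case: s t st ts => [s sP] [t tP] /= st ts; apply: eq_exist => /=.
  by apply/funext => i; apply/eqP; rewrite eqEfsubset st ts.
- have [[s0 As0]|A0] := pselect (exists s, A s); last first.
    exists (exist _ N (conj (fun i => fsubset_refl (N i)) hallN)) => s As.
    by case: A0; exists s.
  pose L i := [fset x in N i | `[< forall s, A s -> x \in sval s i >]].
  have LN i : L i `<=` N i by apply/fsubsetP => x; rewrite !inE => /andP[].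
  have hallL : hall L.
    move=> J.
    (* A member of the chain with least total size over [J] cannot shrink further on [J], so it
       equals the intersection there. *)
    pose P n := `[< exists2 s, A s & n = \sum_(j <- J) #|` sval s j| >].
    have exP : exists n, P n by eexists; apply/asboolP; exists s0.
    case: (ex_minnP exP) => n /asboolP[s As ->] smin.
    suff sL j : j \in J -> L j = sval s j.
      by rewrite (eq_big_seq _ sL); apply: (svalP s).2.
    move=> jJ; apply/fsetP => x; rewrite !inE; apply/andP/idP.
      by case=> _ /asboolP; apply.
    move=> xs; split; first by apply/fsubsetP: xs; apply: (svalP s).1.
    apply/asboolP => t At; apply: contraT => xt.
    have [/asboolP st|/asboolP ts] := Atot _ _ As At; last first.
      by rewrite (fsubsetP (ts j)) in xt.
    have /smin : P (\sum_(j <- J) #|` sval t j|) by apply/asboolP; exists t.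
    rewrite (big_fsetD1 j jJ) [leqRHS](big_fsetD1 j jJ) /=.
    have ltj : #|` sval t j| < #|` sval s j|.
      apply: fproper_ltn_card; rewrite fproperE st /=.
      by apply/fsubsetPn; exists x.
    have lej : \sum_(i <- J `\ j) #|` sval t i| <= \sum_(i <- J `\ j) #|` sval s i|.
      by apply: leq_sum => i _; apply: fsubset_leq_card.
    lia.
  exists (exist _ L (conj LN hallL)) => s As; apply/asboolP => i /=.
  by apply/fsubsetP => x; rewrite !inE => /andP[_ /asboolP]; apply.
- exists M; split=> // M' M'M hallM'.
  have M'N i : M' i `<=` N i by apply: fsubset_trans (M'M i) (MN i).
  have /(congr1 sval) := Mmin (exist _ M' (conj M'N hallM')) (asboolT M'M).
  by [].
Qed.

(* Rado's argument: if two distinct points of [M i] were both indispensable,  *)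
(* the index sets witnessing it would violate Hall's condition for their     *)
(* union or their intersection.                                              *)
Lemma hall_minimal_uniq M :
  hall M -> (forall M', (forall i, M' i `<=` M i) -> hall M' -> M' = M) ->
  forall i x y, x \in M i -> y \in M i -> x = y.
Proof.
move=> hallM Mmin i x y xM yM; apply/eqP; apply: contraT => xy.
pose D z j := if j == i then M i `\ z else M j.
have Dsub z j : D z j `<=` M j.
  by rewrite /D; case: eqP => [->|//]; exact: fsubD1set.
have DS (z : X) (J : {fset I}) : i \notin J ->
    \bigcup_(j <- J) D z j = \bigcup_(j <- J) M j.
  move=> iJ; apply: eq_big_seq => j jJ; rewrite /D; case: eqP => // ji.
  by rewrite -ji jJ in iJ.
(* By minimality, deleting [z] from [M i] breaks Hall's condition at some index set, which must
   contain [i]; the witness is that set without [i]. *)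
have crit z : z \in M i -> exists2 J : {fset I}, i \notin J &
    #|` (M i `\ z) `|` \bigcup_(j <- J) M j| <= #|` J|.
  move=> zM.
  have /existsNP[J] : ~ hall (D z).
    move=> /(Mmin _ (Dsub z))/(congr1 (@^~ i)); rewrite /D eqxx => /fsetP/(_ z).
    by rewrite zM !inE eqxx.
  move/negP; rewrite -ltnNge => ltJ.
  have iJ : i \in J.
    by apply: contraLR ltJ => iJ; rewrite -leqNgt DS //; exact: hallM.
  exists (J `\ i); first by rewrite !inE eqxx.
  move: ltJ; rewrite (big_fsetD1 i iJ) /= DS ?inE ?eqxx // {1}/D eqxx.
  by rewrite (cardfsD1 i J) iJ add1n ltnS fsetUC.
have [J iJ Jle] := crit x xM; have [K iK Kle] := crit y yM.
set U := _ `|` _ in Jle; set V := _ `|` _ in Kle.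
have UV : \bigcup_(j <- i |` (J `|` K)) M j `<=` U `|` V.
  apply/bigfcupsP => j; rewrite !inE => jJK _; apply/fsubsetP => z zM.
  have [zx|zx] := eqVneq z x; case/orP: jJK => [/eqP ji|/orP[jJ|jK]].
  - by rewrite zx ji in zM *; rewrite !inE xy zM !orbT.
  - rewrite !inE; apply/orP; left; apply/orP; right.
    by apply/bigfcupP; exists j; rewrite ?jJ.
  - rewrite !inE; apply/orP; right; apply/orP; right.
    by apply/bigfcupP; exists j; rewrite ?jK.
  - by rewrite /U !inE zx -ji zM.
  - rewrite !inE; apply/orP; left; apply/orP; right.
    by apply/bigfcupP; exists j; rewrite ?jJ.
  - rewrite !inE; apply/orP; right; apply/orP; right.
    by apply/bigfcupP; exists j; rewrite ?jK.
have UI : \bigcup_(j <- J `&` K) M j `<=` U `&` V.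
  apply/bigfcupsP => j; rewrite !inE => /andP[jJ jK] _; apply/fsubsetP => z zM.
  rewrite !inE; apply/andP; split; apply/orP; right.
    by apply/bigfcupP; exists j; rewrite ?jJ.
  by apply/bigfcupP; exists j; rewrite ?jK.
(* Hall's condition gives |U| + |V| >= 1 + |J [|] K| + |J [&] K| = 1 + |J| + |K|, against [Jle] and
   [Kle]. *)
have := leq_trans (hallM _) (fsubset_leq_card UV).
have := leq_trans (hallM _) (fsubset_leq_card UI).
rewrite cardfsU1 !inE (negPf iJ) (negPf iK) /=.
have := cardfsUI U V; have := cardfsUI J K; lia.
Qed.

(** In a minimal subfamily every set is a singleton, and Hall's condition on pairs of indices makes
    these singletons distinct. *)
Lemma hall_matching N : hall N ->
  exists2 f : I -> X, injective f & forall i, f i \in N i.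
Proof.
move=> /hall_minimal[M [MN hallM Mmin]].
have Mu := hall_minimal_uniq hallM Mmin.
have M0 i : exists x, x \in M i.
  have := hallM [fset i]; rewrite big_seq_fset1 cardfs1 cardfs_gt0.
  by move=> /fset0Pn.
pose f i := xchoose (M0 i).
have fM i : f i \in M i by exact: xchooseP.
exists f => [i j fij|i]; last exact/(fsubsetP (MN i))/fM.
apply/eqP; apply: contraT => ij.
have := hallM [fset i; j]; rewrite cardfs2 ij.
suff -> : \bigcup_(k <- [fset i; j]) M k = [fset f i] by rewrite cardfs1.
apply/fsetP => x; rewrite inE; apply/bigfcupP/eqP.
  move=> [k]; rewrite !inE andbT => /orP[]/eqP -> xM; first exact: (Mu i).
  by rewrite fij; exact: (Mu j).
by move=> ->; exists i; rewrite ?fM // !inE eqxx.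
Qed.

End Hall.

(** * From invariant means to Foelner sets *)

Section Means.
Variables (R : realType) (G : groupType).
Implicit Types (mu : set G -> R) (s : G) (A B : set G).

Definition mean mu := [/\ forall A, 0 <= mu A, mu [set: G] = 1
  & forall A B, A `&` B = set0 -> mu (A `|` B) = mu A + mu B].

Definition invariant_by mu s := forall A, mu [set (s * x)%g | x in A] = mu A.

Lemma mean0 mu : mean mu -> mu set0 = 0.
Proof.
case=> _ _ muU; apply: (@addrI _ (mu set0)).
by rewrite -muU ?setI0// setU0 addr0.
Qed.

Lemma mean_bigsetU mu (T : eqType) (K : seq T) (X : T -> set G) : mean mu ->
  uniq K -> {in K &, forall k l, k != l -> X k `&` X l = set0} ->
  mu (\big[setU/set0]_(k <- K) X k) = \sum_(k <- K) mu (X k).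
Proof.
move=> muM; have [_ _ muU] := muM.
elim: K => [|k K IH] /= Ku dis; first by rewrite !big_nil mean0.
case/andP: Ku => kK Ku; rewrite !big_cons muU.
  rewrite IH // => i j iK jK; apply: dis; rewrite inE ?iK ?jK ?orbT//.
rewrite big_distrr /= big_seq big1 // => l lK; apply: dis.
- by rewrite inE eqxx.
- by rewrite inE lK orbT.
- by apply: contraNneq kK => ->.
Qed.

(** The sets on which [f] is left multiplication by a given [k] partition the group, and their
    translates by [k] partition the range of [f]; each piece keeps its mean. *)
Lemma mean_injection mu (K : {fset G}) (f : G -> G) : mean mu ->
  {in K, forall k, invariant_by mu k} -> injective f ->
  (forall x, exists2 k, k \in K & f x = (k * x)%g) -> mu (range f) = 1.
Proof.
move=> muM Kinv finj fK; have [_ mu1 _] := muM.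
pose X k := [set x | f x = (k * x)%g].
have XX k l : k != l -> X k `&` X l = set0.
  move=> kl; apply/seteqP; split => // x [kx lx].
  have /mulIg kl' : (k * x = l * x)%g by rewrite -[LHS]kx.
  by rewrite kl' eqxx in kl.
have -> : range f = \big[setU/set0]_(k <- K) [set (k * x)%g | x in X k].
  rewrite -bigcup_seq; apply/seteqP; split => [_ [x _ <-]|_ [k kK [x Xx <-]]].
    have [k kK fx] := fK x; exists k => //=; exists x => //.
  by exists x.
rewrite mean_bigsetU ?fset_uniq // => [|k l _ _ kl]; last first.
  apply/seteqP; split => // _ [[x Xx <-] [y Xy]].
  rewrite -Xx -Xy => /finj yx; rewrite yx in Xy.
  by have := XX _ _ kl; move=> /seteqP[/(_ x) + _]; apply.
rewrite (eq_big_seq (fun k => mu (X k))); last by move=> k kK; exact: Kinv.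
rewrite -mean_bigsetU ?fset_uniq // => [|k l _ _ /XX//].
rewrite -mu1 -bigcup_seq; congr mu; apply/seteqP; split => // x _.
by have [k kK fx] := fK x; exists k.
Qed.

Local Open Scope fset_scope.

(* A doubling set [K] yields, by Hall's theorem, two injections of [G] into    *)
(* itself with disjoint ranges that move points by elements of [K]; both       *)
(* ranges then have mean [1].                                                *)
Lemma mean_not_doubling mu (K : {fset G}) : mean mu ->
  {in K, forall k, invariant_by mu k} ->
  ~ forall F : {fset G},
      (2 * #|` F| <= #|` \bigcup_(x <- F) [fset (k * x)%g | k in K]|)%N.
Proof.
move=> muM Kinv dbl; have [mu_ge0 mu1 muU] := muM.
(* Each point occurs twice as an index, so a single matching encodes both injections. *)
pose N (i : G * bool) := [fset (k * i.1)%g | k in K].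
have /hall_matching[f finj fN] : hall N.
  move=> J; pose P := [fset i.1 | i in J].
  have -> : \bigcup_(j <- J) N j = \bigcup_(x <- P) [fset (k * x)%g | k in K].
    apply/fsetP => y; apply/bigfcupP/bigfcupP => [[i]|[x]]; rewrite andbT.
      by move=> iJ yi; exists i.1 => //; rewrite andbT; apply/imfsetP; exists i.
    by move=> /imfsetP[i /= iJ ->] yi; exists i; rewrite ?iJ.
  apply: leq_trans (dbl P).
  have /fsubset_leq_card : J `<=`
      [fset (x, true) | x in P] `|` [fset (x, false) | x in P].
    apply/fsubsetP => -[x b] xJ; have xP : x \in P.
      by apply/imfsetP; exists (x, b).
    by rewrite inE; apply/orP; case: b {xJ}; [left|right];
       apply/imfsetP; exists x.
  have cardP (b : bool) : #|` [fset (x, b) | x in P]| = #|` P|.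
    by rewrite card_imfset // => ? ? [].
  by move=> /leq_trans; apply; rewrite cardfsU !cardP; lia.
have fb b : mu (range (fun x => f (x, b))) = 1.
  apply: (mean_injection muM Kinv) => [x y /finj[]//|x].
  by have /imfsetP[k kK ->] := fN (x, b); exists k.
have dis : (range (fun x => f (x, true)) `&` range (fun x => f (x, false))
    = set0)%classic.
  by apply/seteqP; split => // _ [[x _ <-] [y _ /finj]].
have := muU _ _ dis; rewrite !fb => U2.
set U := (_ `|` _)%classic in U2.
have := muU U (~` U)%classic (setICr U); rewrite setUCr mu1 U2.
have := mu_ge0 (~` U)%classic; lra.
Qed.

Definition dilate (S : seq G) (F : {fset G}) : {fset G} :=
  F `|` \bigcup_(s <- S) [fset (s * x)%g | x in F].

Lemma in_dilate S F y : reflect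
  (y \in F \/ exists2 s, s \in S & exists2 x, x \in F & y = (s * x)%g)
  (y \in dilate S F).
Proof.
rewrite inE; apply: (iffP orP) => -[yF|]; [by left| |by left|].
  by move=> /bigfcupP[s]; rewrite andbT => sS /imfsetP[x /= xF ->]; right;
     exists s => //; exists x.
move=> [s sS [x xF ->]]; right; apply/bigfcupP; exists s; rewrite ?sS //.
by apply/imfsetP; exists x.
Qed.

(** Iterated dilation is multiplication by one finite set, the ball of radius [n]; this gives the
    set [K] required by [mean_not_doubling]. *)
Lemma iter_dilate S F n :
  iter n (dilate S) F =
  \bigcup_(x <- F) [fset (k * x)%g | k in iter n (dilate S) [fset 1%g]].
Proof.
elim: n => [|n IH] /=; apply/fsetP => y.
  apply/idP/bigfcupP => [yF|[x]]; rewrite ?andbT.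
    exists y; rewrite ?yF //; apply/imfsetP; exists 1%g; rewrite ?mul1g //.
    by rewrite inE.
  by move=> xF /imfsetP[_ /[!inE] /eqP -> ->]; rewrite mul1g.
apply/in_dilate/bigfcupP; rewrite IH.
  case=> [/bigfcupP[x xF /imfsetP[k /= kK ->]]|].
    by exists x => //; apply/imfsetP; exists k => //; apply/in_dilate; left.
  move=> [s sS [_ /bigfcupP[x xF /imfsetP[k /= kK ->]] ->]].
  exists x => //; apply/imfsetP; exists (s * k)%g; rewrite ?mulgA //=.
  by apply/in_dilate; right; exists s => //; exists k.
move=> [x xF /imfsetP[k /= /in_dilate[kK|[s sS [l lK ->]]] ->]].
  by left; apply/bigfcupP; exists x => //; apply/imfsetP; exists k.
right; exists s => //; exists (l * x)%g; rewrite ?mulgA //.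
by apply/bigfcupP; exists x => //; apply/imfsetP; exists l.
Qed.

Lemma dilate_invariant mu S n : {in S, forall s, invariant_by mu s} ->
  {in iter n (dilate S) [fset 1%g], forall k, invariant_by mu k}.
Proof.
move=> Sinv; elim: n => [|n IH] k /=.
  rewrite inE => /eqP -> A; congr mu; apply/seteqP; split=> [_ [x Ax <-]|x Ax].
    by rewrite mul1g.
  by exists x; rewrite ?mul1g.
move=> /in_dilate[/IH//|[s sS [l lK ->]]] A.
rewrite -[RHS](IH l lK) -[RHS](Sinv s sS); congr mu.
apply/seteqP; split=> [_ [x Ax <-]|_ [_ [x Ax <-] <-]].
  by exists (l * x)%g; [exists x|rewrite mulgA].
by exists x; rewrite ?mulgA.
Qed.

(** Without such an [F], each dilation by [S] enlarges every finite set by a factor 1 + e. By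
    Bernoulli's inequality enough dilations double it, which [mean_not_doubling] forbids. *)
Theorem mean_folner mu (S : seq G) (e : R) : mean mu -> 0 < e ->
  {in S, forall s, invariant_by mu s} ->
  exists2 F : {fset G}, F != fset0 &
    {in S, forall s, #|` [fset x in F | (s * x)%g \notin F]|%:R
                       <= e * #|` F|%:R}.
Proof.
move=> muM e0 Sinv; apply: contrapT => noF.
have expand (F : {fset G}) : (1 + e) * #|` F|%:R <= #|` dilate S F|%:R.
  have [->|F0] := eqVneq F fset0; first by rewrite cardfs0 mulr0.
  have /existsNP[s /not_implyP[sS /negP]] :
      ~ {in S, forall s, #|` [fset x in F | (s * x)%g \notin F]|%:R
                         <= e * #|` F|%:R}.
    by move=> H; apply: noF; exists F.
  rewrite -ltNge => /ltW; set E := [fset x in F | _] => leE.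
  rewrite mulrDl mul1r; apply: le_trans (lerD (lexx _) leE) _.
  rewrite -natrD ler_nat.
  have <- : #|` [fset (s * x)%g | x in E]| = #|` E|.
    by rewrite card_imfset //; exact: mulgI.
  rewrite -cardfsUI [X in (_ + #|` X|)%N](_ : _ = fset0); last first.
    apply/fsetP => y; rewrite !inE; apply/negP => /andP[yF /imfsetP[x]].
    by rewrite !inE => /andP[_ /negP xF] yx; apply: xF; rewrite -yx.
  rewrite cardfs0 addn0; apply/fsubset_leq_card/fsubsetP => y.
  rewrite in_fsetU => /orP[yF|/imfsetP[x /= xE ->]].
    by apply/in_dilate; left.
  have xF : x \in F by move: xE; rewrite !inE => /andP[].
  by apply/in_dilate; right; exists s => //; exists x.
have expandn n (F : {fset G}) :
    (1 + e * n%:R) * #|` F|%:R <= #|` iter n (dilate S) F|%:R.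
  elim: n F => [|n IH] F /=; first by rewrite mulr0 addr0 mul1r.
  apply: le_trans (expand _).
  apply: le_trans (ler_wpM2l _ (IH F)); last lra.
  rewrite mulrA ler_wpM2r // -natr1.
  have : 0 <= n%:R :> R by []. nra.
have [n le_n] : exists n, 1 <= e * n%:R.
  exists (Num.truncn e^-1).+1.
  by rewrite -ler_pdivrMl // mulr1 ltW // truncnS_gt.
apply: (mean_not_doubling muM (dilate_invariant (n := n) Sinv)) => F.
rewrite -iter_dilate -(ler_nat R) natrM; apply: le_trans (expandn n F).
by apply: ler_wpM2r => //; lra.
Qed.

End Means.

(** * Matrix coefficients of the regular representation *)

Section MatrixCoefficients.
Variables (R : realType) (G : groupType) (T : finType) (x : T -> G).
Implicit Types (u v : T -> R) (s : G).

(* The weights [u : T -> R] stand for the vector [\sum_a u a *: delta_(x a)] of *)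
(* the real Hilbert space l2(G), and [dot s u v] for the coefficient <s u, v> *)
(* of the left regular representation.                                       *)
Definition dot s u v := \sum_a \sum_b u a * v b * (s * x a == x b)%g%:R.

Lemma dotC u v : dot 1%g u v = dot 1%g v u.
Proof.
rewrite /dot exchange_big; apply: eq_bigr => a _; apply: eq_bigr => b _.
by rewrite !mul1g eq_sym [u b * _]mulrC.
Qed.

Lemma dot_suml (I : finType) s (u : I -> T -> R) v :
  dot s (fun a => \sum_i u i a) v = \sum_i dot s (u i) v.
Proof.
rewrite /dot [RHS]exchange_big; apply: eq_bigr => a _.
rewrite [RHS]exchange_big; apply: eq_bigr => b _.
by rewrite !mulr_suml.
Qed.

Lemma dot_sumr (I : finType) s u (v : I -> T -> R) :
  dot s u (fun a => \sum_i v i a) = \sum_i dot s u (v i).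
Proof.
rewrite /dot [RHS]exchange_big; apply: eq_bigr => a _.
rewrite [RHS]exchange_big; apply: eq_bigr => b _.
by rewrite mulr_sumr mulr_suml.
Qed.

Lemma dotZl s c u v : dot s (fun a => c * u a) v = c * dot s u v.
Proof.
rewrite /dot mulr_sumr; apply: eq_bigr => a _.
by rewrite mulr_sumr; apply: eq_bigr => b _; rewrite !mulrA.
Qed.

Lemma dotZr s c u v : dot s u (fun a => c * v a) = c * dot s u v.
Proof.
rewrite /dot mulr_sumr; apply: eq_bigr => a _.
by rewrite mulr_sumr; apply: eq_bigr => b _; rewrite !mulrA [u a * c]mulrC.
Qed.

End MatrixCoefficients.

Lemma dot_iso (R : realType) (G K : groupType) (phi : {multiplicative G -> K})
    (psi : K -> G) (T : finType) (x : T -> K) s (u v : T -> R) :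
  cancel phi psi -> cancel psi phi ->
  dot (psi \o x) s u v = dot x (phi s) u v.
Proof.
move=> phiK psiK; apply: eq_bigr => a _; apply: eq_bigr => b _.
by rewrite -(inj_eq (can_inj phiK)) gmulfM /= !psiK.
Qed.

(** * Product vectors on a wreath product *)

Section Tensor.
Variables (R : realType) (G A : groupType) (d : nat) (to : right_action A 'I_d).
Variables (E T : finType) (e : E -> A) (x : T -> G).
Hypothesis e_bij : bijective e.

Definition tensor_pt (p : {ffun 'I_d -> T} * E) : wreath G to :=
  wr [ffun t => x (p.1 t)] (e p.2).

(* The second factor is the uniform unit vector of l2(A), fixed by [A].       *)
Definition tensor (u : 'I_d -> T -> R) (p : {ffun 'I_d -> T} * E) : R :=
  (\prod_t u t (p.1 t)) / Num.sqrt #|E|%:R.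

Lemma act_bij (s : A) : bijective (to^~ s).
Proof.
exists (to^~ s^-1%g) => t; rewrite -actM ?mulgV ?mulVg act1//.
Qed.

(** The wreath element acts at site [t] by [y t] on the content of site [to t s], so the coefficient
    factors over sites. The factor of l2(A) contributes 1, because [s] permutes [A]. *)
Lemma dot_tensor (y : {ffun 'I_d -> G}) (s : A) (u v : 'I_d -> T -> R) :
  dot tensor_pt (wr y s : wreath G to) (tensor u) (tensor v) =
  \prod_t dot x (y t) (u (to t s)) (v t).
Proof.
have [e' eK e'K] := e_bij.
have E0 : #|E|%:R != 0 :> R.
  by rewrite pnatr_eq0 -lt0n; apply/card_gt0P; exists (e' 1%g).
pose F (f f' : {ffun 'I_d -> T}) : R := \prod_t (u (to t s) (f t) * v t (f' t) *
  (y t * x (f t) == x (f' t))%g%:R).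
have -> : \prod_t dot x (y t) (u (to t s)) (v t) = \sum_f \sum_f' F f f'.
  rewrite bigA_distr_bigA; apply: eq_bigr => f _ /=.
  by rewrite bigA_distr_bigA.
have [/= r tor rto] := act_bij s.
rewrite [RHS](reindex (fun f : {ffun 'I_d -> T} => [ffun t => f (to t s)]));
  last first.
  exists (fun f : {ffun 'I_d -> T} => [ffun t => f (r t)]) => f _;
    by apply/ffunP => t; rewrite !ffunE ?tor ?rto.
have FE f f' : F [ffun t => f (to t s)] f' = (\prod_t u t (f t)) *
    (\prod_t v t (f' t)) * \prod_t (y t * x (f (to t s)) == x (f' t))%g%:R.
  rewrite [\prod_t u t (f t)](reindex (to^~ s)) /=; last first.
    by apply: onW_bij; exact: act_bij.
  by rewrite -!big_split /=; apply: eq_bigr => t _; rewrite ffunE.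
transitivity (\sum_(f : {ffun 'I_d -> T}) \sum_(i : E) \sum_(f' : {ffun 'I_d -> T}) \sum_(j : E)
   F [ffun t => f (to t s)] f' * ((s * e i == e j)%g%:R / #|E|%:R)).
  rewrite /dot (pair_bigA _ (fun (f : {ffun 'I_d -> T}) (i : E) =>
    \sum_(f' : {ffun 'I_d -> T}) \sum_(j : E)
    F [ffun t => f (to t s)] f' * ((s * e i == e j)%g%:R / #|E|%:R))) /=.
  apply: eq_bigr => -[f i] _; rewrite pair_bigA /=.
  apply: eq_bigr => -[f' j] _ /=; rewrite /tensor /=.
  have -> : ((wr y s : wreath G to) * tensor_pt (f, i) ==
      tensor_pt (f', j))%g%:R
     = (\prod_t (y t * x (f (to t s)) == x (f' t))%g%:R)
        * (s * e i == e j)%g%:R :> R.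
    rewrite -natr_prod -natrM; congr _%:R.
    rewrite xpair_eqE -mulnb; congr (_ * _)%N.
    have [/forallP /= H|/forallPn[t /= /negPf H]] := boolP [forall t,
        (y t * x (f (to t s)) == x (f' t))%g].
      rewrite big1 => [|t _]; last by rewrite H.
      by apply/eqP; rewrite eqb1; apply/eqP/ffunP => t; rewrite !ffunE /=;
        apply/eqP/H.
    rewrite (bigD1 t) //= H mul0n; apply/eqP; rewrite eqb0.
    apply/negP => /eqP/ffunP/(_ t); rewrite !ffunE /= => /eqP.
    by rewrite H.
  rewrite FE.
  have -> : #|E|%:R^-1 = (Num.sqrt #|E|%:R)^-1 * (Num.sqrt #|E|%:R)^-1 :> R.
    by rewrite -invfM -expr2 sqr_sqrtr.
  ring.
apply: eq_bigr => f _; rewrite exchange_big /=; apply: eq_bigr => f' _.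
under eq_bigr do rewrite -mulr_sumr.
rewrite -mulr_sumr -[RHS]mulr1; congr (_ * _).
transitivity (\sum_(i : E) (#|E|%:R^-1 : R)).
  apply: eq_bigr => i _; rewrite (bigD1 (e' (s * e i)%g)) //= e'K eqxx mul1r.
  rewrite big1 ?addr0// => j ji; rewrite -[in X in X%:R](inj_eq (can_inj e'K)).
  by rewrite eK eq_sym (negPf ji) mul0r.
by rewrite sumr_const -[LHS]mulr_natl mulfV.
Qed.

End Tensor.

(** * Vectors with one distinguished site, and their symmetrization *)

Section SymmetrizedTensor.
Variables (R : realType) (G A : groupType) (d : nat) (to : right_action A 'I_d).
Variables (E T : finType) (e : E -> A) (x : T -> G) (f g : T -> R).
Hypothesis e_bij : bijective e.
Hypotheses (ff : dot x 1%g f f = 1) (gg : dot x 1%g g g = 1).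
Let c := dot x 1%g f g ^+ 2.
(** The squared norm of [\sum_t site t]: d diagonal terms equal to 1 and d (d - 1) others equal to
    [c]. *)
Let N := d%:R * (1 + (d%:R - 1) * c).

Definition one_site (t s : 'I_d) := if t == s then g else f.
Local Notation site t := (@tensor R d E T (one_site t)).
Local Notation pt := (@tensor_pt G A d to E T e x).

(** The translate by [r] carries [g] at the preimage of [s] under [r]. If this is [t], all factors
    are 1; otherwise exactly two sites pair [f] with [g], and their product is [c]. *)
Lemma dot_site (r : A) (s t : 'I_d) :
  dot pt (wr 1%g r) (site s) (site t) = if to t r == s then 1 else c.
Proof.
rewrite dot_tensor // /one_site.
under eq_bigr do rewrite ffunE.
have [<-{s}|ts] := eqVneq (to t r) s.
  apply: big1 => k _; rewrite !(inj_eq (bij_inj (act_bij to r))) eq_sym.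
  by case: eqP.
have [r' rK r'K] := act_bij to r.
have tr' : r' s != t by apply: contraNneq ts => <-; rewrite r'K.
rewrite (bigD1 t) //= (bigD1 (r' s)) //= r'K !eqxx.
rewrite [s == _]eq_sym (negPf ts) [t == _]eq_sym (negPf tr').
rewrite [dot x 1%g g f]dotC big1 ?mulr1// => k /andP[kt kr].
rewrite [t == k]eq_sym (negPf kt); case: eqP => // sk.
by rewrite sk rK eqxx in kr.
Qed.

Definition symmetrized p : R := (Num.sqrt N)^-1 * \sum_t site t p.

Lemma sum_dot_site (t : 'I_d) :
  \sum_(s < d) (if t == s then 1 else c) = 1 + (d%:R - 1) * c.
Proof.
rewrite (bigD1 t) //= eqxx; congr (_ + _).
rewrite (eq_bigr (fun=> c)); last by move=> s; rewrite eq_sym => /negPf ->.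
rewrite sumr_const cardC1 card_ord -[LHS]mulr_natl; congr (_ * _).
by rewrite -subn1 natrB //; case: d t => [[]|].
Qed.

Lemma normsq_gt0 : (0 < d)%N -> 0 < N.
Proof.
rewrite /N; case: (d) => // n _; rewrite -natr1 addrK.
by rewrite mulr_gt0 // ltr_wpDr // mulr_ge0 ?sqr_ge0.
Qed.

Lemma dot_symmetrized (r : A) : (0 < d)%N ->
  dot pt (wr 1%g r) symmetrized symmetrized = 1.
Proof.
move=> /normsq_gt0 N0; rewrite dotZl dotZr dot_suml mulrA -expr2.
under eq_bigr do rewrite dot_sumr.
rewrite exchange_big /=.
under eq_bigr do under eq_bigr do rewrite dot_site.
under eq_bigr do rewrite sum_dot_site.
rewrite sumr_const card_ord -[X in _ * X]mulr_natl -/N.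
by rewrite exprVn sqr_sqrtr ?mulVf ?gt_eqF ?ltW.
Qed.

Lemma dot_symmetrized_site (t : 'I_d) :
  dot pt 1%g symmetrized (site t) ^+ 2 = (1 + (d%:R - 1) * c) / d%:R.
Proof.
have d0 : (0 < d)%N by case: d t => [[]|].
have N0 := normsq_gt0 d0.
rewrite dotZl dot_suml.
under eq_bigr do rewrite (dot_site 1%g) act1.
rewrite sum_dot_site exprMn exprVn sqr_sqrtr ?ltW //.
move: N0; rewrite /N; set k := _ + _; have : d%:R != 0 :> R by rewrite pnatr_eq0 -lt0n.
by move=> ? /gt_eqF/negbT; rewrite mulf_eq0 negb_or => /andP[_ k0]; field; apply/andP.
Qed.

End SymmetrizedTensor.

Lemma dot_indicator (R : realType) (G : groupType) (U F : {fset G}) (s : G) :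
  (F `<=` U)%fset ->
  dot (val : U -> G) s (fun a => (val a \in F)%:R) (fun a => (val a \in F)%:R)
  = #|` [fset a in F | (s * a)%g \in F]%fset|%:R :> R.
Proof.
move=> FU.
transitivity (\sum_(a : U) ((val a \in F) && ((s * val a)%g \in F))%:R : R).
  apply: eq_bigr => a _; rewrite -mulnb natrM.
  have [saF|saF] := boolP ((s * val a)%g \in F); last first.
    rewrite mulr0 big1 // => b _; case: eqP => [sab|]; last by rewrite mulr0.
    by rewrite -sab (negPf saF) mulr0 mul0r.
  rewrite (bigD1 [` fsubsetP FU _ saF]%fset) //= saF eqxx !mulr1 big1 ?addr0 //.
  move=> b; rewrite -val_eqE /= eq_sym => /negPf ->; by rewrite mulr0.
rewrite -(big_seq_fsetE _ _ xpredT
  (fun a => ((a \in F) && ((s * a)%g \in F))%:R : R)) /=.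
rewrite card_fset_sum1 natr_sum.
rewrite -(@big_fset_incl _ _ _ _ [fset a in F | (s * a)%g \in F]%fset).
- by apply: eq_big_seq => a; rewrite !inE /= => ->.
- by apply/fsubsetP => a; rewrite !inE => /andP[aF _]; exact: (fsubsetP FU).
- by move=> a _; rewrite !inE /= => /negPf ->.
Qed.

Lemma finite_predP (T : choiceType) (P : {pred T}) :
  finite_set [set` P] -> exists E : {fset T}, E =i P.
Proof.
move=> /finite_fsetP[E PE]; exists E => a.
by apply/idP/idP => aE; [have : [set` P] a by rewrite PE|
  have : [set` E] a by rewrite -PE].
Qed.

(** * Descent along the levels of the sequence *)

Section Levels.
Variables (R : realType) (Gam : nat -> groupType) (D : DP Gam).
Local Notation H0 := (subgroup_of (dpH D 0)).
Local Notation one i := (first (dpd_gt1 D i)).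

(** The image of [h] in H_i under iterated first coordinates. It is multiplicative because the
    permutation part of an element of H_j fixes the first site. *)
Fixpoint spine i (h : H0) : Gam i :=
  if i is j.+1 then (dpphi D j (spine j h)).1 (one j) else val h.

Lemma spine_prop i (h : H0) : [/\ spine i h \in dpH D i,
  dpact D i (one i) (dpphi D i (spine i h)).2 = one i &
  forall t, t != one i -> (dpphi D i (spine i h)).1 t \in dpA D i.+1].
Proof.
have next j : spine j h \in dpH D j -> [/\ spine j.+1 h \in dpH D j.+1,
    dpact D j (one j) (dpphi D j (spine j h)).2 = one j &
    forall t, t != one j -> (dpphi D j (spine j h)).1 t \in dpA D j.+1].
  move=> hH; have [h' [a [r [r1 /= ->]]]] := dpphiH (SubgroupOf hH).
  split=> // [|t /negPf t1]; rewrite ffunE ?t1; last exact: valP.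
  by rewrite eqxx; exact: valP.
have : spine i h \in dpH D i.
  by elim: i => [|i /next[]//]; exact: valP.
by move=> hH; have [_ ? ?] := next i hH; split.
Qed.

Lemma spineM i (h k : H0) : spine i (h * k)%g = (spine i h * spine i k)%g.
Proof.
elim: i => [|i IH]; first exact: valM.
by rewrite /= IH gmulfM /= ffunE; have [_ -> _] := spine_prop i h.
Qed.

(* As [f] and [g] are unit vectors, <s f, f> = 1 says that [s] fixes [f], and *)
(* <s g, g> >= 1 - delta that [s] almost fixes [g].                           *)
Definition aligned i (S : seq H0) (delta eps : R)
    (T : finType) (x : T -> Gam i) (f g : T -> R) :=
  [/\ {in dpA D i, forall a, dot x a f f = 1}, dot x 1%g g g = 1,
    {in S, forall s, 1 - delta <= dot x (spine i s) g g}
    & 1 - eps <= dot x 1%g f g ^+ 2].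

(** Here [f] and [g] are the normalized indicators of A_i and of a Foelner set for the image of [S].
    With defect 1, nothing is asked of their angle. *)
Lemma aligned_start i (S : seq H0) (delta : R) (m : set H0 -> R) :
  0 < delta -> mean m -> (forall h, invariant_by m h) ->
  exists (T : finType) (x : T -> Gam i) f g, aligned S delta 1 x f g.
Proof.
move=> delta0 [m_ge0 m1 mU] minv.
have [||F F0 SF] := @mean_folner R (Gam i)
    (fun B => m (spine i @^-1` B)) (map (spine i) S) delta _ delta0.
- by split=> // B C BC; rewrite preimage_setU mU // -preimage_setI BC preimage_set0.
- move=> _ /mapP[h hS ->] B; rewrite -[RHS](minv h); congr m.
  apply/seteqP; split=> [k /= [b Bb]|_ [k Bk <-]] /=; last first.
    by exists (spine i k) => //; rewrite spineM.
  move=> hk; exists (h^-1 * k)%g; rewrite ?mulVKg //= spineM -hk.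
  suff -> : (spine i h^-1 = (spine i h)^-1)%g by rewrite mulKg.
  apply: (mulgI (spine i h)); rewrite mulgV -spineM mulgV.
  by apply: (mulgI (spine i 1%g)); rewrite -spineM !mulg1.
have [A AP] := finite_predP (dpA_finite D i).
(* Both indicators need a common index type, so it enumerates both sets. *)
pose U := (F `|` A)%fset.
pose ind (V : {fset Gam i}) (a : U) : R :=
  (Num.sqrt #|` V|%:R)^-1 * (val a \in V)%:R.
have indE V s : (V `<=` U)%fset -> V != fset0 -> dot (val : U -> _) s (ind V) (ind V)
     = #|` [fset a in V | (s * a)%g \in V]%fset|%:R / #|` V|%:R.
  move=> VU V0; rewrite dotZl dotZr dot_indicator // mulrA -expr2 exprVn.
  by rewrite sqr_sqrtr // mulrC.
have ind1 V s : (V `<=` U)%fset -> V != fset0 ->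
    {in V, forall a, s * a \in V}%g -> dot (val : U -> _) s (ind V) (ind V) = 1.
  move=> VU V0 sV; rewrite indE // [X in #|` X|%fset](_ : _ = V); last first.
    by apply/fsetP => a; rewrite !inE /=; case: (boolP (a \in V)) => // /sV.
  by rewrite divff // pnatr_eq0 cardfs_eq0.
have A0 : A != fset0.
  by apply/fset0Pn; exists 1%g; rewrite AP; exact: gpred1.
exists U, val, (ind A), (ind F); split.
- move=> a aA; apply: ind1; rewrite ?fsubsetUr // => b; rewrite !AP.
  exact: gpredM.
- by apply: ind1; rewrite ?fsubsetUl // => a; rewrite mul1g.
- move=> s sS; rewrite indE ?fsubsetUl // ler_pdivlMr ?ltr0n ?cardfs_gt0 //.
  have := SF _ (map_f _ sS).
  have : #|` F| = (#|` [fset a in F | (spine i s * a)%g \in F]%fset| +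
    #|` [fset a in F | (spine i s * a)%g \notin F]%fset|)%N.
    by rewrite !card_fset_sum1; exact: big_fsetID.
  by move=> ->; rewrite natrD; lra.
- by rewrite subrr sqr_ge0.
Qed.

(** The extra conclusion holds because an element of A_i moves the distinguished site, and vectors
    with different sites have inner product c >= 1 - eps. It serves only for the last descent, to
    level 0. *)
Lemma aligned_step i (S : seq H0) (delta eps : R)
    (T : finType) (x : T -> Gam i.+1) (f g : T -> R) :
  0 <= eps -> aligned S delta eps x f g ->
  exists (T' : finType) (x' : T' -> Gam i) (f' g' : T' -> R),
    aligned S delta ((1 - (dpd D i)%:R^-1) * eps) x' f' g' /\
    {in dpA D i, forall a, 1 - eps <= dot x' a g' g'}.
Proof.
move=> eps0 [Af g1 Sg fg].
have [psi phiK psiK] := dpphi_bij D i.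
have f1 : dot x 1%g f f = 1 by apply: Af; exact: gpred1.
have [E EP] := finite_predP (dpA_finite D i).
have EA (a : E) : val a \in dpA D i by rewrite -EP; exact: valP.
pose e (a : E) := SubgroupOf (EA a).
have e_bij : bijective e.
  have AE (s : subgroup_of (dpA D i)) : val s \in E by rewrite EP; exact: valP.
  by exists (fun s => [` AE s]%fset) => s; apply: val_inj.
have d0 : (0 < dpd D i)%N by exact: ltnW (dpd_gt1 D i).
pose pt := tensor_pt (dpact D i) e x.
have isoE s (u v : _ -> R) : dot (psi \o pt) s u v = dot pt (dpphi D i s) u v.
  exact: (@dot_iso R (Gam i) _ (dpphi D i)).
have phi1 : dpphi D i 1%g = 1%g.
  by apply: (mulgI (dpphi D i 1%g)); rewrite -gmulfM !mulg1.
exists ({ffun 'I_(dpd D i) -> T} * E)%type.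
exists (psi \o pt).
exists (symmetrized x f g).
exists (tensor (one_site f g (one i))).
have phiA a (aA : a \in dpA D i) : dpphi D i a = wr 1%g (SubgroupOf aA).
  by rewrite -dpphiA.
do !split.
- by move=> a aA; rewrite isoE phiA dot_symmetrized.
- by rewrite isoE phi1 (dot_site _ e_bij) // act1 eqxx.
- move=> s sS; rewrite isoE; have [_ r1 aA] := spine_prop i s.
  rewrite [dpphi D i _]surjective_pairing dot_tensor // (bigD1 (one i)) //=.
  rewrite /one_site r1 eqxx big1 ?mulr1; first exact: Sg.
  move=> t t1; rewrite [one i == t]eq_sym (negPf t1) ifN; first exact/Af/aA.
  rewrite -[X in X == _]r1; apply: contraNneq t1; move=> /(bij_inj (act_bij _ _)) ->.
  by [].
- rewrite isoE phi1 (dot_symmetrized_site _ e_bij) //.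
  set c := _ ^+ 2 in fg *; rewrite ler_pdivlMr ?ltr0n //.
  set d := (dpd D i)%:R; have d1 : 1 <= d by rewrite ler1n.
  rewrite mulrBl mulrAC mulrBl mulVf ?pnatr_eq0 -?lt0n//.
  nra.
- move=> a aA; rewrite isoE phiA (dot_site _ e_bij) //.
  by case: eqP => // _; lra.
Qed.

End Levels.

(** * Means from almost invariant unit vectors *)

Section VectorMean.
Variables (R : realType) (G : groupType) (T : finType) (g : T -> R).
Implicit Types (x : T -> G) (s : G) (B : set G) (U : {fset G}).

(** [x] need not be injective, so the coordinate at [z] collects a whole fibre. *)
Definition coords x (z : G) := \sum_(a | x a == z) g a.

Definition support_in x U := forall a, x a \in U.

Lemma sum_coords x U (F : G -> R) : support_in x U ->
  \sum_(z <- U) coords x z * F z = \sum_a g a * F (x a).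
Proof.
move=> xU; transitivity (\sum_(z <- U) \sum_a g a * (x a == z)%:R * F z).
  apply: eq_bigr => z _; rewrite /coords big_mkcond mulr_suml.
  by apply: eq_bigr => a _; case: eqP; rewrite ?mulr1 // !(mulr0, mul0r).
rewrite exchange_big; apply: eq_bigr => a _.
rewrite (big_fsetD1 (x a)) //= eqxx mulr1 big_seq big1 ?addr0//.
by move=> z; rewrite !inE eq_sym => /andP[/negPf -> _]; rewrite mulr0 mul0r.
Qed.

Lemma dot_coords x s : dot x s g g = \sum_a g a * coords x (s * x a)%g.
Proof.
apply: eq_bigr => a _; rewrite /coords mulr_sumr [RHS]big_mkcond /=.
by apply: eq_bigr => b _; rewrite eq_sym; case: eqP; rewrite ?mulr1 ?mulr0.
Qed.

(** The sum over B of the squared coordinates, written over [T] so that no support has to be chosen;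
    see [vector_meanE]. *)
Definition vector_mean x B := \sum_a g a * (coords x (x a) * (x a \in B)%:R).

Lemma vector_meanE x U B : support_in x U ->
  vector_mean x B = \sum_(z <- U) coords x z ^+ 2 * (z \in B)%:R.
Proof.
move=> xU; rewrite /vector_mean.
rewrite -(sum_coords (fun z => coords x z * (z \in B)%:R) xU).
by apply: eq_bigr => z _; rewrite mulrA.
Qed.

Lemma support_ex x : exists U, support_in x U.
Proof.
by exists [fset x a | a in T]%fset => a; apply/imfsetP; exists a.
Qed.

Lemma mean_vector_mean x : dot x 1%g g g = 1 -> mean (vector_mean x).
Proof.
move=> g1; have [U xU] := support_ex x; split=> [B||A B AB].
- rewrite (vector_meanE _ xU); apply: sumr_ge0 => z _.
  by rewrite mulr_ge0 ?sqr_ge0.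
- rewrite -g1 dot_coords; apply: eq_bigr => a _.
  by rewrite in_setT mulr1 mul1g.
- rewrite -big_split; apply: eq_bigr => a _ /=.
  rewrite -!mulrDr -natrD; congr (_ * (_ * _%:R)).
  rewrite in_setU; have [aA|] := boolP (x a \in A); last by [].
  have [aB|//] := boolP (x a \in B).
  have : (A `&` B) (x a) by split; exact: set_mem.
  by rewrite AB.
Qed.

Lemma vector_mean_translate x s B :
  vector_mean x [set (s * z)%g | z in B] = vector_mean (fun a => s^-1 * x a)%g B.
Proof.
apply: eq_bigr => a _; congr (_ * (_ * _%:R)).
  by apply: eq_bigl => b; rewrite (inj_eq (mulgI _)).
congr (nat_of_bool _); apply/idP/idP => /set_mem H; apply/mem_set.
  by case: H => z Bz <-; rewrite mulKg.
by exists (s^-1 * x a)%g; rewrite ?mulVKg.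
Qed.

(* |u^2 - v^2| <= (t (u - v)^2 + (u + v)^2 / t) / 2, and the sum of (u - v)^2 is *)
(* 2 - 2 <s g, g>.                                                           *)
Lemma vector_mean_almost_invariant x s (t : R) B : 0 < t ->
  dot x 1%g g g = 1 -> 1 - t ^- 2 <= dot x s g g ->
  `|vector_mean x [set (s * z)%g | z in B] - vector_mean x B| <= 3 / t.
Proof.
move=> t0 g1 sg; pose y a := (s^-1 * x a)%g.
have [U0 xU0] := support_ex x; have [U1 yU1] := support_ex y.
pose U := (U0 `|` U1)%fset.
have xU : support_in x U by move=> a; rewrite inE xU0.
have yU : support_in y U by move=> a; rewrite inE yU1 orbT.
rewrite vector_mean_translate -/y !(vector_meanE _ xU) (vector_meanE _ yU).
have yx z : coords y z = coords x (s * z)%g.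
  by apply: eq_bigl => a; rewrite -(inj_eq (mulgI s)) mulVKg.
have xx : \sum_(z <- U) coords x z * coords x z = 1.
  rewrite sum_coords // -g1 dot_coords; apply: eq_bigr => a _.
  by rewrite mul1g.
have yy : \sum_(z <- U) coords y z * coords y z = 1.
  rewrite sum_coords // -g1 dot_coords; apply: eq_bigr => a _.
  by rewrite yx mulVKg mul1g.
have xy : \sum_(z <- U) coords x z * coords y z = dot x s g g.
  rewrite sum_coords // dot_coords; apply: eq_bigr => a _.
  by rewrite yx.
rewrite -sumrB; apply: le_trans (ler_norm_sum _ _ _) _.
pose bound z := t / 2 * (coords y z * coords y z + coords x z * coords x z
    - 2 * (coords x z * coords y z))
  + t^-1 / 2 * (coords y z * coords y z + coords x z * coords x z
    + 2 * (coords x z * coords y z)).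
apply: (@le_trans _ _ (\sum_(z <- U) bound z)).
  apply: ler_sum => z _; rewrite /bound.
  move: (coords y z) (coords x z) => u v.
  rewrite -mulrBl; apply: (@le_trans _ _ `|u ^+ 2 - v ^+ 2|).
    by rewrite normrM ler_piMr //; case: (_ \in B); rewrite ?normr1 ?normr0.
  rewrite -subr_ge0.
  have tt : t * t^-1 = 1 by rewrite divff ?gt_eqF.
  have ti0 : 0 < t^-1 by rewrite invr_gt0.
  have -> : t / 2 * (u * u + v * v - 2 * (v * u)) +
      t^-1 / 2 * (u * u + v * v + 2 * (v * u)) =
      t^-1 / 2 * ((t * (u - v)) ^+ 2 + (u + v) ^+ 2).
    by field; rewrite gt_eqF.
  have -> : `|u ^+ 2 - v ^+ 2| = t^-1 / 2 * (2 * `|t * (u - v)| * `|u + v|).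
    by rewrite subr_sqr !normrM (gtr0_norm t0); field; rewrite gt_eqF.
  rewrite -mulrBr mulr_ge0 //; first by rewrite divr_ge0 // ltW.
  rewrite -(real_normK (num_real (t * _))) -(real_normK (num_real (u + v))).
  have sq (p q : R) : 0 <= p ^+ 2 + q ^+ 2 - 2 * p * q.
    by have := sqr_ge0 (p - q); rewrite sqrrB; lra.
  exact: sq.
rewrite /bound big_split /= -!mulr_sumr.
rewrite sumrB !big_split /= -!mulr_sumr xx yy xy.
have k1 : dot x s g g <= 1.
  have : 0 <= \sum_(z <- U) (coords x z - coords y z) ^+ 2.
    by apply: sumr_ge0 => z _; exact: sqr_ge0.
  have -> : \sum_(z <- U) (coords x z - coords y z) ^+ 2 = \sum_(z <- U)
      (coords x z * coords x z + coords y z * coords y z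
        - 2 * (coords x z * coords y z)).
    by apply: eq_bigr => z _; ring.
  by rewrite sumrB big_split /= -mulr_sumr xx yy xy; lra.
(* With k = <s g, g> the total is t (1 - k) + (1 + k) / t; the first term is at most 1 / t and the
   second at most 2 / t. *)
have ti0 : 0 < t^-1 by rewrite invr_gt0.
have tk : t * (1 - dot x s g g) <= t^-1.
  apply: (@le_trans _ _ (t * t ^- 2)); first by rewrite ler_pM2l //; lra.
  by rewrite expr2 invfM mulrA divff ?mul1r ?gt_eqF.
nra.
Qed.

End VectorMean.

Lemma ultra_fmap (T U : Type) (f : T -> U) (F : set_system T) :
  UltraFilter F -> UltraFilter (f @ F).
Proof.
move=> FU; apply: Build_UltraFilter => H HP FH.
apply/seteqP; split=> [B HB|B]; last exact: FH.
have [//|FB] := in_ultra_setVsetC (f @^-1` B) FU.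
have /FH HnB : (f @ F) (~` B) by [].
have : H (B `&` ~` B) by exact: filterI.
by rewrite setICr => /filter_not_empty.
Qed.

(** The limit is taken along an ultrafilter refining [\oo]. It exists since [0, 1] is compact, it
    respects sums, and it agrees with ordinary limits. *)
Lemma limit_mean (R : realType) (G : groupType) (mu : nat -> set G -> R)
    (S : set G) : (forall n, mean (mu n)) ->
  (forall s, S s -> forall B,
     (fun n => mu n [set (s * z)%g | z in B] - mu n B) @ \oo --> (0 : R)) ->
  exists2 m : set G -> R, mean m & forall s, S s -> invariant_by m s.
Proof.
move=> muM muS.
have [U [UU ooU]] := ultraFilterLemma (@eventually_filter).
have le1 n B : mu n B <= 1.
  have [ge0 m1 mD] := muM n.
  by rewrite -m1 -(setUCr B) mD ?setICr // lerDl.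
have /choice[m mP] : forall B, exists l, (fun n => mu n B) @ U --> (l : R).
  move=> B; have := @segment_compact R 0 1; rewrite compact_ultra.
  move=> /(_ ((fun n => mu n B) @ U) (ultra_fmap _ _)).
  case=> [|l [_ ?]]; last by exists l.
  by apply: (@filterE _ U) => n /=; rewrite in_itv /= le1 andbT; case: (muM n).
exists m; first split.
- by move=> B; apply: (cvgr_to_ge (mP B)); apply: filterE => n; case: (muM n).
- have mu1 : (fun n => mu n [set: G]) = fun=> 1.
    by apply/funext => n; case: (muM n).
  have := mP [set: G]; rewrite mu1 => m1.
  exact: (cvg_unique _ m1 (cvg_cst _)).
- move=> A B AB.
  have muD : (fun n => mu n (A `|` B)) = (fun n => mu n A + mu n B).
    by apply/funext => n; case: (muM n) => _ _ ->.
  have := mP (A `|` B); rewrite muD => mAB.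
  exact: (cvg_unique _ mAB (cvgD (mP A) (mP B))).
- move=> s Ss B; apply/eqP; rewrite -subr_eq0; apply/eqP.
  apply: (cvg_unique _ (cvgB (mP _) (mP B))) => // V V0.
  exact/ooU/(muS s Ss B V V0).
Qed.

(** * Vanishing of the defect *)

Section Amenability.
Variables (R : realType) (Gam : nat -> groupType) (D : DP Gam).
Local Notation H0 := (subgroup_of (dpH D 0)).
Local Notation d := (dpd D).

Lemma contraction_ge0 j : 0 <= 1 - (d j)%:R^-1 :> R.
Proof.
by rewrite subr_ge0 invf_le1 ?ler1n ?ltr0n ltnW // dpd_gt1.
Qed.

Lemma aligned_ex (S : seq H0) (delta : R) (m : set H0 -> R) (k i : nat) :
  0 < delta -> mean m -> (forall h, invariant_by m h) ->
  exists (T : finType) (x : T -> Gam i) f g,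
    aligned S delta (\prod_(i <= j < (i + k)%N) (1 - (d j)%:R^-1)) x f g.
Proof.
move=> delta0 mM minv; elim: k i => [|k IH] i.
  by rewrite addn0 big_geq //; exact: aligned_start minv.
rewrite addnS big_ltn ?ltnS ?leq_addr //.
have [T [x [f [g nfg]]]] := IH i.+1.
have [|T' [x' [f' [g' []]]]] := aligned_step _ nfg.
  by apply: prodr_ge0 => j _; exact: contraction_ge0.
by rewrite addSn; exists T', x', f', g'.
Qed.

(** From [M] on, the factors are at most (j - 1) / j and telescope to (M - 1) / (M + n - 1); the
    earlier ones are at most 1. *)
Lemma prod_telescope (e : R) (M : nat) : 0 < e -> (1 < M)%N ->
  (forall j, (M <= j)%N -> (d j <= j)%N) ->
  exists k, \prod_(1 <= j < k.+1) (1 - (d j)%:R^-1) <= e.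
Proof.
move=> e0 M1 dM.
have M0 : 0 < M%:R - 1 :> R by rewrite subr_gt0 ltr1n.
have bound n : \prod_(1 <= j < (M + n)%N) (1 - (d j)%:R^-1) <=
    (M%:R - 1) / ((M + n)%N%:R - 1) :> R.
  elim: n => [|n IH].
    rewrite addn0 divff ?gt_eqF //.
    rewrite big_nat; elim/big_rec: _ => // j x _ x1.
    apply: le_trans (_ : (1 - (d j)%:R^-1) * 1 <= 1).
      by rewrite ler_wpM2l // contraction_ge0.
    by rewrite mulr1 gerBl invr_ge0.
  rewrite addnS big_nat_recr /=; last by lia.
  have -> : (M%:R - 1) / ((M + n).+1%N%:R - 1) =
     (M%:R - 1) / ((M + n)%N%:R - 1) * (1 - (M + n)%N%:R^-1) :> R.
    have : 1 < (M + n)%N%:R :> R by rewrite ltr1n; lia.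
    rewrite -natr1; move: (M + n)%N%:R => x x1.
    by field; rewrite !gt_eqF //; lra.
  apply: ler_pM => //; last 1 first.
  - rewrite lerD2l lerN2 lef_pV2 ?posrE ?ltr0n.
    + by rewrite ler_nat dM // leq_addr.
    + by lia.
    + by rewrite ltnW // dpd_gt1.
  - by apply: prodr_ge0 => j _; exact: contraction_ge0.
  - exact: contraction_ge0.
pose n := (Num.truncn ((M%:R - 1) / e)).+1.
exists (M + n).-1%N; rewrite prednK; last by lia.
apply: le_trans (bound n) _; rewrite natrD.
have nM : (M%:R - 1) / e < n%:R by exact: truncnS_gt.
rewrite ler_pdivrMr; last by have : 0 <= n%:R :> R by []; lra.
rewrite ltr_pdivrMr // in nM.
have : 0 < e * (M%:R - 1) by exact: mulr_gt0.
nra.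
Qed.

(** The defect is brought below [delta] at level 1; the last step then turns it into almost
    invariance under A_0. *)
Lemma almost_invariant_vector (S : seq H0) (delta : R) (m : set H0 -> R) (M : nat) :
  0 < delta -> mean m -> (forall h, invariant_by m h) ->
  (1 < M)%N -> (forall j, (M <= j)%N -> (d j <= j)%N) ->
  exists (T : finType) (x : T -> Gam 0%N) g, [/\ dot x 1%g g g = 1,
    {in dpA D 0, forall a, 1 - delta <= dot x a g g} &
    {in S, forall s, 1 - delta <= dot x (val s) g g}].
Proof.
move=> delta0 mM minv M1 dM.
have [k ke] := prod_telescope delta0 M1 dM.
have [T [x [f [g nfg]]]] := aligned_ex S k 1 delta0 mM minv.
have [|T' [x' [f' [g' [[_ g1 Sg _] Ag]]]]] := aligned_step _ nfg.
  by apply: prodr_ge0 => j _; exact: contraction_ge0.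
exists T', x', g'; split=> // a aA; apply: le_trans (Ag a aA).
by rewrite lerD2l lerN2.
Qed.

End Amenability.

(** * From generators to the whole group *)

Section Stabilizer.
Variables (R : realType) (G : groupType) (m : set G -> R).

Definition stabilizer : {pred G} := fun s => `[< invariant_by m s >].

Lemma stabilizer1 : 1%g \in stabilizer.
Proof.
apply/asboolP => B; rewrite -[in RHS](image_id B); congr m.
by congr (_ @` _); apply/funext => z; rewrite mul1g.
Qed.

Lemma stabilizerM : {in stabilizer &, forall s t, (s * t)%g \in stabilizer}.
Proof.
move=> s t /asboolP ms /asboolP mt; apply/asboolP => B.
rewrite -[RHS](mt B) -[RHS]ms image_comp; congr m.
by congr (_ @` _); apply/funext => z; rewrite /= mulgA.
Qed.

Lemma stabilizerV : {in stabilizer, forall s, s^-1%g \in stabilizer}.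
Proof.
move=> s /asboolP ms; apply/asboolP => B.
rewrite -[LHS]ms image_comp -[in RHS](image_id B); congr m.
by congr (_ @` _); apply/funext => z; rewrite /= mulVKg.
Qed.

HB.instance Definition _ := isMulClosed.Build G stabilizer stabilizerM.
HB.instance Definition _ := isInvClosed.Build G stabilizer stabilizerV.
HB.instance Definition _ := isMul1Closed.Build G stabilizer stabilizer1.

End Stabilizer.

Lemma mean_iso (R : realType) (G K : groupType) (f : {multiplicative G -> K})
    (m : set K -> R) : bijective f -> mean m -> (forall s, invariant_by m s) ->
  amenable R G.
Proof.
move=> [f' fK f'K] [m_ge0 m1 mU] minv.
exists (fun A => m (f' @^-1` A)); split=> // [A B AB|s A].
  by rewrite preimage_setU mU // -preimage_setI AB preimage_set0.
rewrite -[RHS](minv (f s)); congr m; apply/seteqP; split=> [z [y Ay yz]|_ [z Az <-]].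
  by exists (f y); rewrite /= ?fK // -gmulfM yz f'K.
by exists (f' z); rewrite // -[in RHS](f'K z) -gmulfM fK.
Qed.

Theorem theorem1p1 (R : realType) (G : groupType) (Gam : nat -> groupType)
    (D : DP Gam) (isoG : isomorphic G (Gam 0%N))
    (amH : amenable R (subgroup_of (dpH D 0%N)))
    (subln : (fun k : nat => (dpd D k)%:R / ln (k%:R : R)) @ \oo --> (0 : R)) :
  amenable R G.
Proof.
have [mu [mu_ge0 mu1 muU muinv]] := amH.
(* Eventually d_j < log j < j. *)
have [M M1 dM] : exists2 M, (1 < M)%N &
    forall j, (M <= j)%N -> (dpd D j <= j)%N.
  have [N _ NP] := @cvgr0_norm_lt _ _ _ _ _ _ subln 1 ltr01.
  exists (maxn N 2) => [|j]; first by lia.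
  rewrite geq_max => /andP[Nj j1]; have := NP j Nj.
  have l0 : 0 < ln (j%:R : R) by rewrite ln_gt0 // ltr1n.
  rewrite normrM normfV (gtr0_norm l0) normr_nat ltr_pdivrMr // mul1r.
  move=> /lt_trans/(_ (ln_sublinear _)); rewrite ltr0n ltr_nat => lt.
  by apply/ltnW/lt; lia.
have [F FH Fgen] := dpH_fg D 0.
have muM : mean mu by split.
have muI h : invariant_by mu h by exact: muinv.
(* Taking delta = (n + 1)^-2, that is t = n + 1, bounds the defect of invariance by 3 / (n + 1). *)
have vec n : exists m : set (Gam 0%N) -> R, mean m /\
    forall s, s \in dpA D 0 \/ s \in F -> forall B,
      `|m [set (s * z)%g | z in B] - m B| <= 3 / n.+1%:R.
  have n0 : 0 < n.+1%:R :> R by rewrite ltr0n.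
  have [|T [x [g [g1 Ag Fg]]]] := almost_invariant_vector (pmap insub F)
    (_ : 0 < n.+1%:R ^- 2) muM muI M1 dM; first by rewrite invr_gt0 exprn_gt0.
  exists (vector_mean g x); split; first exact: mean_vector_mean.
  move=> s sAF B; apply: vector_mean_almost_invariant => //.
  case: sAF => [/Ag//|sF].
  rewrite -[s]/(val (SubgroupOf (FH s sF))); apply: Fg.
  by rewrite mem_pmap_sub.
have [m /all_and2[mM mS]] := choice vec.
have [|n nM nS] := @limit_mean R (Gam 0%N) m
  [set s | s \in dpA D 0 \/ s \in F] mM.
  move=> s sAF B; apply/norm_cvg0P.
  apply: (@squeeze_cvgr _ _ _ _ (fun=> 0) (fun n => 3 * harmonic n)).
  - by apply: nearW => n; rewrite normr_ge0 mS.
  - exact: cvg_cst.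
  - by rewrite -[X in _ --> X](mulr0 (3 : R)); apply: cvgM;
      [exact: cvg_cst|exact: cvg_harmonic].
(* The stabilizer of the limit mean is a subgroup containing A_0 and the generators of H_0, hence
   everything. *)
pose K : groupClosed (Gam 0%N) := stabilizer n.
have nI s : s \in K.
  apply: (@dp_gen _ D 0%N K) => // t /orP[tA|tH]; first by apply/asboolP; apply: nS; left.
  by apply: (Fgen K) => // r rF; apply/asboolP; apply: nS; right.
have [f f_bij] := isoG.
by apply: (mean_iso f_bij nM) => s; apply/asboolP/nI.
Qed.
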